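(* Let $\Lambda$ be a finite dimensional algebra over a field, $k\ge1$ an integer and $M$ a finitely generated right $\Lambda$-module. If $k\text{-}\operatorname{ddell}M<\infty$, then $(k+1)\text{-}\operatorname{ddell}(\Omega M)<\infty$, and therefore $k\text{-}\operatorname{ddell}(\Omega M)<\infty$.
   Context: $\mathrm{mod}\,\Lambda$ is the category of finitely generated right $\Lambda$-modules. $\mathbb N$ is the set of nonnegative integers; the infimum of the empty set is $+\infty$. $\Omega M$ is the kernel of a projective cover of $M$, $\Omega^0M=M$, $\Omega^{n+1}M=\Omega(\Omega^nM)$. ''$U$ is a direct summand of $V$ up to projective summands'' means that $U$ is isomorphic to a direct summand of $V\oplus P$ for some projective $P$. For an integer $j\ge1$, $j\text{-}\operatorname{dell}M$ is the infimum of all $n\in\mathbb N$ such that $\Omega^nM$ is a direct summand of $\Omega^{n+j}N$ up to projective summands for some $N\in\mathrm{mod}\,\Lambda$. $k\text{-}\operatorname{ddell}M$ is the infimum of all $m\in\mathbb N$ for which there exist $0\le n\le m$ and an exact sequence $0\to C_n\to\cdots\to C_1\to C_0\to M\to0$ in $\mathrm{mod}\,\Lambda$ with $(i+k)\text{-}\operatorname{dell}C_i\le m-i$ for $i=0,\dots,n$. *)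

(* Defs.v *)
From mathcomp Require Import all_boot all_order all_algebra all_field.
From mathcomp Require Import boolp classical_sets constructive_ereal.

Set Implicit Arguments.
Unset Strict Implicit.
Unset Printing Implicit Defensive.

Import Order.TTheory GRing.Theory Num.Theory.

Local Open Scope classical_set_scope.
Local Open Scope ring_scope.

(* [lmodType R] is the type of left R-modules, and everything below is stated
   for left modules; right modules over A are [lmodType A^c], with A^c the
   opposite ring. *)

Definition finitely_generated (R : pzRingType) (V : lmodType R) : Prop :=
  exists (n : nat) (g : 'I_n -> V),
    forall x : V, exists c : 'I_n -> R, x = \sum_(i < n) c i *: g i.

Record fgModType (R : pzRingType) := FgMod {
  fgmod_sort :> lmodType R;
  fgmodP : finitely_generated fgmod_sort }.

Definition right_fgModType (R : pzRingType) := fgModType R^c.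

Section Modules.
Variable R : pzRingType.

Definition ker (U V : lmodType R) (f : {linear U -> V}) : set U :=
  [set x | f x = 0].

Definition isomorphic (U V : lmodType R) : Prop :=
  exists f : {linear U -> V}, bijective f.

Definition projective (P : lmodType R) : Prop :=
  forall (U V : lmodType R) (g : {linear U -> V}) (f : {linear P -> V}),
    range g = setT -> exists h : {linear P -> U}, forall x, g (h x) = f x.

Definition superfluous (V : lmodType R) (K : set V) : Prop :=
  forall U : {pred V}, submod_closed U ->
    (forall x, exists2 u, u \in U & exists2 y, K y & x = u + y) ->
    forall x, x \in U.

Definition projective_cover (P M : fgModType R) (p : {linear P -> M}) : Prop :=
  [/\ projective P, range p = setT & superfluous (ker p)].

Definition is_syzygy (M K : fgModType R) : Prop :=
  exists (P : fgModType R) (p : {linear P -> M}) (i : {linear K -> P}),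
    [/\ projective_cover p, injective i & range i = ker p].

(* Omega M, as a representative of its isomorphism class. The default value M
   is never used over a finite dimensional algebra A: every finitely generated
   A-module has a projective cover, with a finitely generated kernel. *)
Definition syzygy (M : fgModType R) : fgModType R :=
  if pselect (exists K, is_syzygy M K) is left exK then projT1 (cid exK) else M.

Definition syzygy_iter (n : nat) (M : fgModType R) : fgModType R :=
  iter n syzygy M.

Definition stable_summand (U V : fgModType R) : Prop :=
  exists2 P : fgModType R, projective P &
    exists W : fgModType R, isomorphic (U * W)%type (V * P)%type.

(* The exact sequence 0 -> C_n -> ... -> C_0 -> M -> 0 is extended by zero
   modules C_i for i > n, so that exactness at C_n says that C_n -> C_(n-1)
   (or C_0 -> M if n = 0) is injective. *)
Definition exact_resolution (n : nat) (M : fgModType R)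
    (C : nat -> fgModType R) (d : forall i, {linear C i.+1 -> C i})
    (e : {linear C 0%N -> M}) : Prop :=
  [/\ forall i, (n < i)%N -> forall x : C i, x = 0,
      forall i, range (d i.+1) = ker (d i),
      range (d 0%N) = ker e
    & range e = setT].

End Modules.

(* Infimum in N u {+oo}, whose elements are embedded into [\bar int]; the
   infimum of the empty set is +oo. *)
Definition nat_inf (S : set nat) : \bar int :=
  infimum +oo%E [set (n%:Z)%:E | n in S].

Section DelooingLevels.
Variable R : pzRingType.

Definition dell (j : nat) (M : fgModType R) : \bar int :=
  nat_inf [set n | exists N : fgModType R,
    stable_summand (syzygy_iter n M) (syzygy_iter (n + j) N)].

Definition ddell (k : nat) (M : fgModType R) : \bar int :=
  nat_inf [set m | exists n : nat, (n <= m)%N /\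
    exists (C : nat -> fgModType R) (d : forall i, {linear C i.+1 -> C i})
           (e : {linear C 0%N -> M}),
      exact_resolution n d e /\
      forall i, (i <= n)%N -> (dell (i + k) (C i) <= (m%:Z - i%:Z)%:E)%E].

End DelooingLevels.

(* Main.v *)
(* Let 0 -> C_n -> ... -> C_0 -> M -> 0 be a resolution witnessing
   k-ddell M <= m. Take a projective cover Q_0 -> M, lift it to
   pi_0 : Q_0 -> C_0, and take projective covers pi_i : Q_i -> C_i for i >= 1.
   The exact complex
     ... -> Q_2 (+) Q_3 -> Q_1 (+) Q_2 -> Q_0 (+) Q_1 -> Q_0 -> 0,
     (a, b) |-> (0, a),
   maps onto the resolution of M by (a, b) |-> pi_i a + d_i (pi_(i+1) b), so the
   kernels D_i form a resolution of Omega M. By Schanuel's lemma D_i agrees with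
   Omega C_i up to projective summands. As Omega preserves stable summands, if
   Omega^l C_i is a stable summand of Omega^(l+i+k) N, then Omega^l D_i is one
   of Omega^(l+i+k+1) N; thus (k+1)-ddell (Omega M) <= m.

   Projective covers exist because a minimal submodule of a free module that
   still maps onto M is projective. *)

Require Import Defs.
From HB Require Import structures.
From mathcomp Require Import all_boot all_order all_algebra all_field.
From mathcomp Require Import boolp classical_sets constructive_ereal.

Set Implicit Arguments.
Unset Strict Implicit.
Unset Printing Implicit Defensive.

Import Order.TTheory GRing.Theory Num.Theory.

Local Open Scope classical_set_scope.
Local Open Scope ring_scope.

Definition linear_of (R : pzRingType) (U V : lmodType R) (f : U -> V)
    (fL : linear f) : {linear U -> V} :=
  HB.pack_for {linear U -> V} f (GRing.isLinear.Build R U V *:%R f fL).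

Definition is_submodule (R : pzRingType) (V : lmodType R) (S : set V) : Prop :=
  S 0 /\ forall a x y, S x -> S y -> S (a *: x + y).

Section Submodule.
Variables (R : pzRingType) (V : lmodType R) (S : {pred V}).

Definition submod_type of submod_closed S := {x : V | x \in S}.

Variable clS : submod_closed S.

HB.instance Definition _ := SubChoice.on (submod_type clS).
HB.instance Definition _ :=
  GRing.SubChoice_isSubLmodule.Build R V S (submod_type clS)
    (GRing.submod_closed_semi clS).

End Submodule.

Section LinearAlgebra.
Variable R : pzRingType.
Implicit Types U V W : lmodType R.

Lemma is_submodule_ker U V (f : {linear U -> V}) : is_submodule (ker f).
Proof.
split=> [|a x y]; rewrite /ker /= ?linear0 // => fx fy.
by rewrite linearP fx fy scaler0 addr0.
Qed.

Lemma is_submodule_image U V (f : {linear U -> V}) S :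
  is_submodule S -> is_submodule (f @` S).
Proof.
case=> S0 SP; split; first by exists 0; rewrite ?linear0.
move=> a _ _ [x Sx <-] [y Sy <-]; exists (a *: x + y); last by rewrite linearP.
exact: SP.
Qed.

Lemma is_submodule_range U V (f : {linear U -> V}) : is_submodule (range f).
Proof. by apply: is_submodule_image. Qed.

Lemma submod_closedP V (S : {pred V}) :
  submod_closed S -> is_submodule [set x | x \in S].
Proof. by case=> S0 SP; split=> // a x y; apply: SP. Qed.

Lemma submodule_object V (S : set V) : is_submodule S ->
  exists (K : lmodType R) (i : {linear K -> V}), injective i /\ range i = S.
Proof.
move=> [S0 SP].
have clS : submod_closed [pred x | `[< S x >]].
  split=> [|a x y]; first exact: asboolT.
  by move=> /asboolW Sx /asboolW Sy; apply/asboolT/SP.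
exists (submod_type clS), (val : {linear submod_type clS -> V}).
split; first exact: val_inj.
apply/seteqP; split=> [_ [x _ <-]|x Sx] /=.
  exact: (asboolW (proj2_sig x)).
by exists (exist _ x (asboolT Sx)).
Qed.

Lemma linear_factor U V W (i : {linear U -> V}) (f : {linear W -> V}) :
  injective i -> range f `<=` range i ->
  exists g : {linear W -> U}, forall x, i (g x) = f x.
Proof.
move=> i_inj sub_fi.
have [g gE] : {g : W -> U & forall x, i (g x) = f x}.
  by apply: (choice (P := fun x y => i y = f x)) => x;
    have [|y _ yx] := sub_fi (f x); [exists x | exists y].
have gL : linear g by move=> a x y; apply: i_inj; rewrite linearP !gE linearP.
by exists (linear_of gL).
Qed.

Lemma linear_injP U V (f : {linear U -> V}) :
  (forall x, f x = 0 -> x = 0) -> injective f.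
Proof.
move=> f0 x y fxy; apply/eqP; rewrite -subr_eq0; apply/eqP/f0.
by rewrite linearB fxy subrr.
Qed.

Lemma linear_bij_inv U V (f : {linear U -> V}) :
  injective f -> range f = setT ->
  exists g : {linear V -> U}, cancel f g /\ cancel g f.
Proof.
move=> f_inj f_surj.
have idL : linear (id : V -> V) by [].
have [|g gK] := linear_factor (f := linear_of idL) f_inj.
  by rewrite f_surj.
by exists g; split=> // x; apply: f_inj; rewrite gK.
Qed.

Lemma range_setT U V (f : {linear U -> V}) :
  (forall y, exists x, f x = y) -> range f = setT.
Proof.
by move=> fs; apply/seteqP; split=> // y _; have [x <-] := fs y; exists x.
Qed.

Lemma range_setTP U V (f : {linear U -> V}) :
  range f = setT -> forall y, exists x, f x = y.
Proof. by move=> fT y; have [x _ <-] : range f y by [rewrite fT]; exists x. Qed.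

End LinearAlgebra.

Lemma is_submodule_rowspace (F : fieldType) (n : nat) (S : set 'rV[F]_n) :
  is_submodule S ->
  exists m (B : 'M[F]_(m, n)), forall v, S v <-> (v <= B)%MS.
Proof.
move=> [S0 SP].
pose good r := `[< exists m (B : 'M[F]_(m, n)),
  (forall v, (v <= B)%MS -> S v) /\ \rank B = r >].
have ex_good : exists r, good r.
  exists 0%N; apply/asboolP; exists 0%N, 0; split; last exact: mxrank0.
  by move=> v /submx0null ->.
have good_ub r : good r -> (r <= n)%N.
  by move=> /asboolP[m [B [_ <-]]]; apply: rank_leq_col.
have [r /asboolP[m [B [SB rB]]] r_max] := ex_maxnP ex_good good_ub.
exists m, B => v; split=> [Sv|]; last exact: SB.
have : good (\rank (B + v)%MS).
  apply/asboolP; exists _, (B + v)%MS; split=> // w /sub_addsmxP[[u1 u2] ->] /=.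
  rewrite [u2]mx11_scalar mul_scalar_mx addrC.
  by apply: SP => //; apply: SB; apply: submxMl.
move=> /r_max; rewrite -rB => leB.
have [_] := mxrank_leqif_sup (addsmxSl B v).
rewrite eqn_leq leB mxrankS ?addsmxSl //= => /esym.
by rewrite addsmx_sub => /andP[].
Qed.

Definition finite_over_field (R : pzRingType) : Prop :=
  exists (F : fieldType) (phi : F -> R) (d : nat) (e : 'I_d -> R),
    [/\ forall a b, phi (a + b) = phi a + phi b,
        forall a b, phi (a * b) = phi a * phi b
      & forall r, exists c : 'I_d -> F, r = \sum_i phi (c i) * e i].

Definition fg_submodule (R : pzRingType) (V : lmodType R) (S : set V) : Prop :=
  exists (n : nat) (g : 'I_n -> V), (forall i, S (g i)) /\
    forall x, S x -> exists c : 'I_n -> R, x = \sum_i c i *: g i.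

Section Length.
Variable R : pzRingType.
Hypothesis finR : finite_over_field R.

(* [rk S] is the dimension of the preimage of [S] under a semilinear surjection
   from a finite dimensional vector space onto [V]. *)
Lemma submodule_rank (V : fgModType R) :
  exists (N : nat) (rk : set V -> nat),
    (forall S, (rk S <= N)%N) /\
    (forall S T, is_submodule S -> is_submodule T -> S `<=` T ->
      (rk S <= rk T)%N /\ ((rk T <= rk S)%N -> S = T)) /\
    (forall S : set V, is_submodule S -> fg_submodule S).
Proof.
have [F [phi [d [e [phiD phiM phi_span]]]]] := finR.
have [n [g g_span]] := fgmodP V.
have phi0 : phi 0 = 0 by apply: (addrI (phi 0)); rewrite -phiD !addr0.
pose f (v : 'rV[F]_(n * d)) : V :=
  \sum_(j < n) \sum_(i < d) phi (v 0 (mxvec_index j i)) * e i *: g j.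
have f0 : f 0 = 0.
  by rewrite /f !big1 // => j _; rewrite big1 // => i _;
    rewrite mxE phi0 mul0r scale0r.
have fP a u v : f (a *: u + v) = phi a *: f u + f v.
  rewrite /f scaler_sumr -big_split; apply: eq_bigr => j _.
  rewrite /= scaler_sumr -big_split; apply: eq_bigr => i _ /=.
  by rewrite !mxE phiD phiM !mulrDl scalerDl -mulrA scalerA.
have f_surj x : exists v, f v = x.
  have [c ->] := g_span x.
  have [b bE] : {b : 'I_n -> 'I_d -> F &
      forall j, c j = \sum_i phi (b j i) * e i}.
    by apply: (choice (P := fun j b => c j = \sum_i phi (b i) * e i)) => j;
      apply: phi_span.
  exists (mxvec (\matrix_(j, i) b j i)); apply: eq_bigr => j _.
  rewrite bE scaler_suml; apply: eq_bigr => i _.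
  by rewrite mxvecE mxE.
have subP S : is_submodule S -> is_submodule (f @^-1` S).
  move=> [S0 SP]; split=> /= [|a u v Su Sv]; first by rewrite f0.
  by rewrite fP; apply: SP.
have [Bm BmP] : {B : set V -> {m : nat & 'M[F]_(m, n * d)} &
    forall S, is_submodule S -> forall v, S (f v) <-> (v <= projT2 (B S))%MS}.
  apply: (choice (P := fun S B => is_submodule S ->
    forall v, S (f v) <-> (v <= projT2 B)%MS)) => S.
  have [Ss|nS] := pselect (is_submodule S); last first.
    by exists (existT (fun m => 'M[F]_(m, n * d)) 0%N (0 : 'M_(0, n * d))).
  have [m [B BP]] := is_submodule_rowspace (subP _ Ss).
  by exists (existT _ m B).
exists (n * d)%N, (fun S => \rank (projT2 (Bm S))); split; last split.
- by move=> S; apply: rank_leq_col.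
- move=> S T Ss Ts ST.
  have sST : (projT2 (Bm S) <= projT2 (Bm T))%MS.
    by apply/row_subP => i; apply/(BmP _ Ts)/ST/(BmP _ Ss); apply: row_sub.
  split; first exact: mxrankS.
  move=> leTS; apply/seteqP; split=> // x Tx.
  have [v vx] := f_surj x; rewrite -vx; apply/(BmP _ Ss).
  have sTS : (projT2 (Bm T) <= projT2 (Bm S))%MS.
    have [_] := mxrank_leqif_sup sST.
    by rewrite eqn_leq leTS mxrankS // => /esym.
  by apply: submx_trans sTS; apply/(BmP _ Ts); rewrite vx.
- move=> S Ss; case: (Bm S) (BmP _ Ss) => m B /= BP.
  exists m, (fun i => f (row i B)); split=> [i|x Sx].
    by apply/BP; apply: row_sub.
  have [v vx] := f_surj x; have : (v <= B)%MS by apply/BP; rewrite vx.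
  move=> /submxP[D vD]; exists (fun i => phi (D 0 i)).
  have f_sum (I : Type) (r : seq I) (c : I -> F) (w : I -> 'rV_(n * d)) :
      f (\sum_(i <- r) c i *: w i) = \sum_(i <- r) phi (c i) *: f (w i).
    by elim: r => [|i r IHr]; rewrite ?big_nil ?f0 // !big_cons fP IHr.
  by rewrite -vx vD mulmx_sum_row f_sum.
Qed.

Lemma fg_submodule_object (V : fgModType R) (S : set V) : is_submodule S ->
  exists (K : fgModType R) (i : {linear K -> V}), injective i /\ range i = S.
Proof.
move=> Ss; have [N [rk [_ [_ fgS]]]] := submodule_rank V.
have [n [g [Sg g_span]]] := fgS _ Ss.
have [K [i [i_inj iS]]] := submodule_object Ss.
have fgK : finitely_generated K.
  have [h hE] : {h : 'I_n -> K & forall j, i (h j) = g j}.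
    apply: (choice (P := fun j y => i y = g j)) => j.
    by have [y _ yE] : range i (g j) by [rewrite iS]; exists y.
  exists n, h => x; have [|c cE] := g_span (i x).
    by rewrite -iS; exists x.
  exists c; apply: i_inj; rewrite cE linear_sum; apply: eq_bigr => j _.
  by rewrite linearZ hE.
by exists (FgMod fgK), i.
Qed.

Lemma minimal_submodule (V : fgModType R) (P : set V -> Prop) (S0 : set V) :
  is_submodule S0 -> P S0 ->
  exists S, [/\ is_submodule S, P S &
    forall T, is_submodule T -> P T -> T `<=` S -> T = S].
Proof.
move=> S0s PS0; have [N [rk [_ [rkP _]]]] := submodule_rank V.
pose good r := `[< exists S, [/\ is_submodule S, P S & rk S = r] >].
have ex_good : exists r, good r by exists (rk S0); apply/asboolP; exists S0.
have [r /asboolP[S [Ss PS rS]] r_min] := ex_minnP ex_good.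
exists S; split=> // T Ts PT TS; have [_] := rkP _ _ Ts Ss TS; apply.
by rewrite rS; apply: r_min; apply/asboolP; exists T.
Qed.

Lemma surjective_endo_inj (V : fgModType R) (h : {linear V -> V}) :
  range h = setT -> injective h.
Proof.
move=> h_surj; have [N [rk [rk_ub [rkP _]]]] := submodule_rank V.
pose K n : set V := [set x | iter n h x = 0].
have iterP n a x y : iter n h (a *: x + y) = a *: iter n h x + iter n h y.
  by elim: n => //= n ->; rewrite linearP.
have iter0 n : iter n h 0 = 0 by elim: n => //= n ->; rewrite linear0.
have Ks n : is_submodule (K n).
  split=> [|a x y]; rewrite /K /= ?iter0 // iterP => -> ->.
  by rewrite scaler0 addr0.
have KS n : K n `<=` K n.+1 by move=> x; rewrite /K /= => ->; rewrite linear0.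
have ex_good : exists r, `[< exists n, rk (K n) = r >].
  by exists (rk (K 0%N)); apply/asboolP; exists 0%N.
have ub r : `[< exists n, rk (K n) = r >] -> (r <= N)%N.
  by move=> /asboolP[n <-].
have [r /asboolP[n rn] r_max] := ex_maxnP ex_good ub.
have KE : K n = K n.+1.
  have [_] := rkP _ _ (Ks n) (Ks n.+1) (KS n); apply.
  by rewrite rn; apply: r_max; apply/asboolP; exists n.+1.
have iter_surj m x : exists y, iter m h y = x.
  elim: m x => [|m IHm] x; first by exists x.
  have [z zx] := range_setTP h_surj x; have [y yz] := IHm z.
  by exists y; rewrite /= yz.
apply: linear_injP => x hx; have [y yx] := iter_surj n x.
have : K n.+1 y by rewrite /K /= yx.
by rewrite -KE /K /= yx.
Qed.

End Length.

Section Modules.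
Variable R : pzRingType.
Implicit Types (U V W P : lmodType R).

Lemma fg_prod (V W : fgModType R) : finitely_generated (V * W)%type.
Proof.
have [n [g g_span]] := fgmodP V; have [m [h h_span]] := fgmodP W.
exists (n + m)%N, (fun i => match split i with
  inl j => (g j, 0) | inr j => (0, h j) end) => -[x y].
have [b ->] := g_span x; have [c ->] := h_span y.
exists (fun i => match split i with inl j => b j | inr j => c j end).
rewrite big_split_ord /=.
have splitl i : split (lshift m i) = inl i := unsplitK (inl i).
have splitr i : split (rshift n i) = inr i := unsplitK (inr i).
under [X in _ = X + _]eq_bigr do rewrite splitl.
under [X in _ = _ + X]eq_bigr do rewrite splitr.
apply/pair_equal_spec; split.
  rewrite /= !raddf_sum /= [X in _ + X]big1 ?addr0 // => i _.
  by rewrite scaler0.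
by rewrite /= !raddf_sum /= [X in X + _]big1 ?add0r // => i _; rewrite scaler0.
Qed.

Definition fg_prod_module (V W : fgModType R) : fgModType R :=
  FgMod (fg_prod V W).

Lemma projective_prod P V : projective P -> projective V ->
  projective (P * V)%type.
Proof.
move=> prP prV X Y g f g_surj.
have inlL : linear (fun x : P => (x, 0) : P * V).
  by move=> a x y; congr pair; rewrite /= scaler0 addr0.
have inrL : linear (fun x : V => (0, x) : P * V).
  by move=> a x y; congr pair; rewrite /= scaler0 addr0.
have [h hE] := prP X Y g (f \o linear_of inlL) g_surj.
have [k kE] := prV X Y g (f \o linear_of inrL) g_surj.
have hkL : linear (fun z : P * V => h z.1 + k z.2).
  move=> a x y /=; rewrite !linearP scalerDr !addrA; congr (_ + _).
  by rewrite -!addrA; congr (_ + _); rewrite addrC.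
exists (linear_of hkL) => -[x y] /=; rewrite linearD hE kE /= -linearD.
by congr (f _); congr pair; rewrite /= ?addr0 ?add0r.
Qed.

Lemma free_lift n V (g : 'I_n -> V) :
  exists f : {linear 'rV[R]_n -> V}, forall x, f x = \sum_i x 0 i *: g i.
Proof.
have fL : linear (fun x : 'rV[R]_n => \sum_i x 0 i *: g i).
  move=> a x y; rewrite scaler_sumr -big_split; apply: eq_bigr => i _ /=.
  by rewrite !mxE scalerDl scalerA.
by exists (linear_of fL).
Qed.

Lemma free_projective n : projective ('rV[R]_n : lmodType R).
Proof.
move=> U V g f g_surj.
have [u uE] : {u : 'I_n -> U & forall i, g (u i) = f (delta_mx 0 i)}.
  by apply: (choice (P := fun i y => g y = f (delta_mx 0 i))) => i;
    apply: range_setTP.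
have [h hE] := free_lift u.
exists h => x; rewrite hE {2}[x]row_sum_delta !linear_sum.
by apply: eq_bigr => i _; rewrite !linearZ uE.
Qed.

Lemma free_fg n : finitely_generated ('rV[R]_n : lmodType R).
Proof.
exists n, (fun i => delta_mx 0 i) => x; exists (fun i => x 0 i).
exact: row_sum_delta.
Qed.

Definition free_module n : fgModType R := FgMod (free_fg n).

Lemma retract_projective P V (i : {linear P -> V}) (r : {linear V -> P}) :
  cancel i r -> projective V -> projective P.
Proof.
move=> ir prV X Y g f g_surj; have [h hE] := prV X Y g (f \o r) g_surj.
by exists (h \o i) => x /=; rewrite hE /= ir.
Qed.

Definition projective_presentation (M P K : fgModType R) (p : {linear P -> M})
    (i : {linear K -> P}) : Prop :=
  [/\ projective P, range p = setT, injective i & range i = ker p].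

Lemma schanuel (M P P' K K' : fgModType R)
    (p : {linear P -> M}) (i : {linear K -> P})
    (p' : {linear P' -> M}) (i' : {linear K' -> P'}) :
  projective_presentation p i -> projective_presentation p' i' ->
  isomorphic (K * P')%type (K' * P)%type.
Proof.
move=> [prP p_surj i_inj iE] [prP' p'_surj i'_inj i'E].
have [h hE] := prP _ _ p' p p'_surj; have [h' h'E] := prP' _ _ p p' p_surj.
have pi x : p (i x) = 0 by have : range i (i x) by [exists x]; rewrite iE.
have p'i' x : p' (i' x) = 0.
  by have : range i' (i' x) by [exists x]; rewrite i'E.
have fL : linear (fun z : K * P' => i z.1 + h' z.2).
  move=> a x y /=; rewrite !linearP scalerDr !addrA; congr (_ + _).
  by rewrite -!addrA; congr (_ + _); rewrite addrC.
have f'L : linear (fun z : K' * P => i' z.1 + h z.2).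
  move=> a x y /=; rewrite !linearP scalerDr !addrA; congr (_ + _).
  by rewrite -!addrA; congr (_ + _); rewrite addrC.
have gL : linear (fun z : K * P' => z.2 - h (i z.1 + h' z.2)).
  move=> a x y /=; rewrite -[i _ + _]/(linear_of fL (a *: x + y)).
  rewrite linearP linearP /=.
  by rewrite scalerBr opprD !addrA; congr (_ + _); rewrite addrAC.
have g'L : linear (fun z : K' * P => z.2 - h' (i' z.1 + h z.2)).
  move=> a x y /=; rewrite -[i' _ + _]/(linear_of f'L (a *: x + y)).
  rewrite linearP linearP /=.
  by rewrite scalerBr opprD !addrA; congr (_ + _); rewrite addrAC.
have [|k kE] := linear_factor (f := linear_of gL) i'_inj.
  move=> _ [[x y] _ <-]; rewrite i'E /ker /=.
  by rewrite linearB hE linearD pi add0r h'E subrr.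
have [|k' k'E] := linear_factor (f := linear_of g'L) i_inj.
  move=> _ [[x y] _ <-]; rewrite iE /ker /=.
  by rewrite linearB h'E linearD p'i' add0r hE subrr.
have FL : linear (fun z : K * P' => (k z, i z.1 + h' z.2) : K' * P).
  move=> a x y; congr pair; first exact: linearP.
  exact: (fL a x y).
exists (linear_of FL).
exists (fun z => (k' z, i' z.1 + h z.2)) => -[x y] /=.
  have E : i' (k (x, y)) + h (i x + h' y) = y by rewrite kE /= subrK.
  congr pair => //; apply: i_inj; rewrite k'E /= E.
  by rewrite addrK.
have E : i (k' (x, y)) + h' (i' x + h y) = y by rewrite k'E /= subrK.
congr pair => //; apply: i'_inj; rewrite kE /= E.
by rewrite addrK.
Qed.

Lemma stable_summand_trans (V U W : fgModType R) :
  stable_summand U V -> stable_summand V W -> stable_summand U W.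
Proof.
move=> [P prP [X [f [f' ff' f'f]]]] [Q prQ [Y [g [g' gg' g'g]]]].
exists (fg_prod_module Q P); first exact: projective_prod.
exists (fg_prod_module X Y).
pose F (z : U * (X * Y)) : W * (Q * P) :=
  let v := f (z.1, z.2.1) in let w := g (v.1, z.2.2) in (w.1, (w.2, v.2)).
pose G (z : W * (Q * P)) : U * (X * Y) :=
  let v := g' (z.1, z.2.1) in let w := f' (v.1, z.2.2) in (w.1, (w.2, v.2)).
have FL : linear F.
  move=> a x y; rewrite /F /=.
  rewrite -[(a *: x.1 + y.1, _)]/(a *: (x.1, x.2.1) + (y.1, y.2.1)) linearP.
  set v := f (x.1, _); set v' := f (y.1, _).
  rewrite -[((a *: v + v').1, _)]/(a *: (v.1, x.2.2) + (v'.1, y.2.2)).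
  by rewrite linearP.
exists (linear_of FL); exists G.
  move=> [u [x y]]; rewrite /F /G /= -surjective_pairing gg' /=.
  by rewrite -surjective_pairing ff'.
move=> [u [x y]]; rewrite /F /G /= -surjective_pairing f'f /=.
by rewrite -surjective_pairing g'g.
Qed.

End Modules.

Section Syzygies.
Variable R : pzRingType.
Hypothesis finR : finite_over_field R.
Implicit Types M U V N C : fgModType R.

Lemma projective_cover_exists M :
  exists (P : fgModType R) (p : {linear P -> M}), projective_cover p.
Proof.
have [n [g g_span]] := fgmodP M; have [p0 p0E] := free_lift g.
have p0_surj x : exists y, p0 y = x.
  have [c ->] := g_span x; exists (\row_i c i); rewrite p0E.
  by apply: eq_bigr => i _; rewrite mxE.
pose onto (S : set (free_module R n)) := forall x, exists2 y, S y & p0 y = x.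
have Ts : is_submodule [set: free_module R n] by [].
have ontoT : onto setT by move=> x; have [y <-] := p0_surj x; exists y.
have [S [Ss S_onto S_min]] := minimal_submodule finR Ts ontoT.
have [P [i [i_inj iS]]] := fg_submodule_object finR Ss.
pose p : {linear P -> M} := p0 \o i.
have p_surj : range p = setT.
  apply: range_setT => x; have [y Sy <-] := S_onto x.
  by have [z _ <-] : range i y by [rewrite iS]; exists z.
have [h hE] := free_projective p0 p_surj.
have ih_surj : range (h \o i) = setT.
  apply: range_setT => y.
  have rs : is_submodule (range (i \o h \o i)) by apply: is_submodule_range.
  have rE : range (i \o h \o i) = S.
    apply: S_min => // [x|_ [x _ <-]]; last by rewrite -iS; exists (h (i x)).
    have [z <-] := range_setTP p_surj x.
    exists (i (h (i z))); first by exists z.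
    by rewrite -[LHS]/(p (h (i z))) hE.
  have [z _ /i_inj zy] : range (i \o h \o i) (i y) by rewrite rE -iS; exists y.
  by exists z.
have ih_inj := surjective_endo_inj finR ih_surj.
have [r [ihK _]] := linear_bij_inv ih_inj ih_surj.
exists P, p; split=> //.
  exact: (@retract_projective _ _ _ i (r \o h) ihK (@free_projective R n)).
move=> U /submod_closedP Us Uker x.
have iUE : i @` [set y | y \in U] = S.
  apply: S_min; first exact: is_submodule_image.
    move=> m; have [y <-] := range_setTP p_surj m.
    have [u uU [z pz ->]] := Uker y; exists (i u); first by exists u.
    by rewrite linearD pz addr0.
  by rewrite -iS => _ [u _ <-]; exists u.
have [u uU /i_inj <- //] : (i @` [set y | y \in U]) (i x).
by rewrite iUE -iS; exists x.
Qed.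

Lemma syzygyP M : is_syzygy M (syzygy M).
Proof.
rewrite /syzygy; case: pselect => [exK|[]]; first by case: (cid exK).
have [P [p pP]] := projective_cover_exists M.
have [K [i [i_inj iE]]] := fg_submodule_object finR (is_submodule_ker p).
by exists K, P, p, i; split.
Qed.

Lemma syzygy_presentation M :
  exists (P : fgModType R) (p : {linear P -> M}) (i : {linear syzygy M -> P}),
    projective_presentation p i.
Proof.
by have [P [p [i [[prP p_surj _] i_inj iE]]]] := syzygyP M; exists P, p, i.
Qed.

Lemma presentation_stable_summand (M P K : fgModType R) (p : {linear P -> M})
    (i : {linear K -> P}) :
  projective_presentation p i -> stable_summand K (syzygy M).
Proof.
move=> pres; have [Q [q [j presM]]] := syzygy_presentation M.
exists P; first by case: pres.
by exists Q; apply: schanuel pres presM.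
Qed.

Lemma stable_summand_syzygy U V :
  stable_summand U V -> stable_summand (syzygy U) (syzygy V).
Proof.
move=> [P prP [W [f f_bij]]].
have [f' ff' f'f] := f_bij.
have [A [p [a [prA p_surj a_inj aE]]]] := syzygy_presentation U.
have [B [q [b [prB q_surj b_inj bE]]]] := syzygy_presentation W.
have [C [r [c [prC r_surj c_inj cE]]]] := syzygy_presentation V.
have pqL : linear (fun z : A * B => f (p z.1, q z.2)).
  move=> s x y /=; rewrite -(linearP f); congr (f _).
  by congr pair; rewrite linearP.
have abL : linear (fun z : syzygy U * syzygy W => (a z.1, b z.2) : A * B).
  by move=> s x y; congr pair; rewrite linearP.
have rL : linear (fun z : C * P => (r z.1, z.2) : V * P).
  by move=> s x y; congr pair; rewrite linearP.
have cL : linear (fun x : syzygy V => (c x, 0) : C * P).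
  by move=> s x y; congr pair; rewrite ?linearP //= scaler0 addr0.
have pres1 : @projective_presentation _ (fg_prod_module V P)
    (fg_prod_module A B) (fg_prod_module (syzygy U) (syzygy W))
    (linear_of pqL) (linear_of abL).
  split; first exact: projective_prod.
  - apply: range_setT => z; have [x xE] := range_setTP p_surj (f' z).1.
    have [y yE] := range_setTP q_surj (f' z).2.
    by exists (x, y) => /=; rewrite xE yE -surjective_pairing f'f.
  - by move=> [x y] [x' y'] [/a_inj -> /b_inj ->].
  - apply/seteqP; split=> [_ [[x y] _ <-]|[x y]]; rewrite /ker /=.
      have -> : p (a x) = 0 by have : range a (a x) by [exists x]; rewrite aE.
      have -> : q (b y) = 0 by have : range b (b y) by [exists y]; rewrite bE.
      exact: linear0.
    move=> fpq; have /(congr1 f') := fpq; rewrite ff'.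
    rewrite -(linear0 f) ff' => -[px qy].
    have [x' _ <-] : range a x by rewrite aE.
    have [y' _ <-] : range b y by rewrite bE.
    by exists (x', y').
have pres2 : @projective_presentation _ (fg_prod_module V P)
    (fg_prod_module C P) (syzygy V) (linear_of rL) (linear_of cL).
  split; first exact: projective_prod.
  - apply: range_setT => -[x y]; have [z <-] := range_setTP r_surj x.
    by exists (z, y).
  - by move=> x y [/c_inj].
  - apply/seteqP; split=> [_ [x _ <-]|[x y]]; rewrite /ker /=.
      have -> // : r (c x) = 0.
      by have : range c (c x) by [exists x]; rewrite cE.
    case=> rx ->; have [x' _ <-] : range c x by rewrite cE.
    by exists x'.
have [g [g' gg' g'g]] := schanuel pres1 pres2.
exists (fg_prod_module A B); first exact: projective_prod.
exists (fg_prod_module (syzygy W) (fg_prod_module C P)).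
have GL : linear (fun z : syzygy U * (syzygy W * (C * P)) =>
    g ((z.1, z.2.1), z.2.2)).
  by move=> s x y; rewrite -(linearP g).
exists (linear_of GL).
exists (fun z => let w := g' z in (w.1.1, (w.1.2, w.2))).
  by move=> [x [y z]] /=; rewrite gg'.
by move=> z /=; case E : (g' z) => [[x y] w] /=; rewrite -E g'g.
Qed.

Lemma stable_summand_syzygy_iter n U V :
  stable_summand U V -> stable_summand (syzygy_iter n U) (syzygy_iter n V).
Proof. by move=> UV; elim: n => //= n; apply: stable_summand_syzygy. Qed.

End Syzygies.

Section SyzygyResolution.
Variable R : pzRingType.
Hypothesis finR : finite_over_field R.

Lemma projective_cover_zero (P M : fgModType R) (p : {linear P -> M}) :
  projective_cover p -> (forall x : M, x = 0) -> forall x : P, x = 0.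
Proof.
move=> [_ _ p_sup] M0 x.
have U0 : submod_closed (pred1 (0 : P)).
  split=> [|a u v]; first exact: eqxx.
  by move=> /eqP-> /eqP->; rewrite scaler0 addr0; apply: eqxx.
apply/eqP/(p_sup _ U0) => y; exists 0; first exact: eqxx.
by exists y; rewrite ?add0r.
Qed.

Lemma syzygy_resolution (n : nat) (M : fgModType R) (C : nat -> fgModType R)
    (d : forall i, {linear C i.+1 -> C i}) (e : {linear C 0%N -> M}) :
  exact_resolution n d e ->
  exists (D : nat -> fgModType R) (d' : forall i, {linear D i.+1 -> D i})
         (e' : {linear D 0%N -> syzygy M}),
    exact_resolution n d' e' /\
    forall i, stable_summand (D i) (syzygy (C i)).
Proof.
move=> [C0 d_exact de_exact e_surj].
have [P [p [a [prP p_surj a_inj aE]]]] := syzygy_presentation finR M.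
have [s sE] := prP _ _ e p e_surj.
have cover (N : fgModType R) :
    {Q : fgModType R & {q : {linear Q -> N} | projective_cover q}}.
  have /cid[Q /cid[q qP]] := projective_cover_exists finR N.
  by exists Q, q.
pose Q i := if i is j.+1 then projT1 (cover (C j.+1)) else P.
pose q i : {linear Q i -> C i} :=
  match i return {linear Q i -> C i} with
  | 0 => s | j.+1 => sval (projT2 (cover (C j.+1))) end.
have qP i : projective_cover (q i.+1) := svalP (projT2 (cover (C i.+1))).
have prQ i : projective (Q i) by case: i => [|i] //; case: (qP i).
have q_surj i x : exists y, q i.+1 y = x.
  by have [_ qT _] := qP i; apply: range_setTP qT x.
have Q0 i : (n < i.+1)%N -> forall x : Q i.+1, x = 0.
  by move=> /C0; apply: projective_cover_zero (qP i).
have ed x : e (d 0%N x) = 0.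
  by have : range (d 0%N) (d 0%N x) by [exists x]; rewrite de_exact.
have dd i x : d i (d i.+1 x) = 0.
  by have : range (d i.+1) (d i.+1 x) by [exists x]; rewrite d_exact.
pose X i := fg_prod_module (Q i) (Q i.+1).
have rL i : linear (fun z : X i => q i z.1 + d i (q i.+1 z.2)).
  move=> c x y /=; rewrite !linearP scalerDr !addrA; congr (_ + _).
  by rewrite -!addrA; congr (_ + _); rewrite addrC.
pose r i : {linear X i -> C i} := linear_of (rL i).
have kernel i : {K : fgModType R & {j : {linear K -> X i} |
    injective j /\ range j = ker (r i)}}.
  have /cid[K /cid[j jP]] := fg_submodule_object finR (is_submodule_ker (r i)).
  by exists K, j.
pose D i := projT1 (kernel i).
pose j i : {linear D i -> X i} := sval (projT2 (kernel i)).
have j_inj i : injective (j i) by case: (svalP (projT2 (kernel i))).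
have jE i : range (j i) = ker (r i) by case: (svalP (projT2 (kernel i))).
have qj i x : q i (j i x).1 = - d i (q i.+1 (j i x).2).
  have : range (j i) (j i x) by exists x.
  by rewrite jE => /eqP; rewrite addr_eq0 => /eqP.
have jP i u v : q i u + d i (q i.+1 v) = 0 -> exists x, j i x = (u, v).
  by move=> uv; have [x _ <-] : range (j i) (u, v) by [rewrite jE]; exists x.
have d'_exists i : {f : {linear D i.+1 -> D i} |
    forall x, j i (f x) = (0, (j i.+1 x).1)}.
  have fL : linear (fun x => (0, (j i.+1 x).1) : X i).
    by move=> c x y; congr pair; rewrite ?linearP //= scaler0 addr0.
  apply: cid; apply: (linear_factor (f := linear_of fL)) => //.
  move=> _ [x _ <-]; rewrite jE /ker /= linear0 add0r.
  by rewrite qj linearN dd oppr0.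
pose d' i := sval (d'_exists i).
have d'E i x : j i (d' i x) = (0, (j i.+1 x).1) := svalP (d'_exists i) x.
have [e' e'E] : exists e' : {linear D 0%N -> syzygy M},
    forall x, a (e' x) = (j 0%N x).1.
  apply: (linear_factor (f := fst \o j 0%N)) => //.
  move=> _ [x _ <-]; rewrite aE /ker /= -sE.
  by rewrite -[s _]/(q 0%N _) qj linearN ed oppr0.
have d'_onto i x : (j i x).1 = 0 -> range (d' i) x.
  move=> x1; have := qj i x; rewrite x1 linear0 => /esym/eqP.
  rewrite oppr_eq0 => /eqP dq0.
  have [c _ cE] : range (d i.+1) (q i.+1 (j i x).2) by rewrite d_exact.
  have [b bc] := q_surj i.+1 c.
  have [|y yE] := jP i.+1 (j i x).2 (- b).
    by rewrite -cE linearN bc linearN subrr.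
  exists y => //; apply: j_inj.
  by rewrite d'E yE /= -x1 -surjective_pairing.
exists D, d', e'; split; first split.
- case=> // i ni x; apply: j_inj; rewrite linear0.
  case: (j _ x) => u v; congr pair; apply: Q0 => //.
  exact: ltnW.
- move=> i; apply/seteqP; split=> [_ [y _ <-]|x].
    by apply: j_inj; rewrite !d'E linear0.
  move=> /(congr1 (j i)); rewrite d'E linear0 => /(congr1 snd).
  exact: d'_onto.
- apply/seteqP; split=> [_ [y _ <-]|x].
    by apply: a_inj; rewrite e'E d'E linear0.
  by move=> /(congr1 a); rewrite e'E linear0; apply: (d'_onto 0%N).
- apply: range_setT => y.
  have ay : p (a y) = 0 by have : range a (a y) by [exists y]; rewrite aE.
  have [c _ cE] : range (d 0%N) (s (a y)) by rewrite de_exact /ker /= sE.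
  have [b bc] := q_surj 0%N c.
  have [|x xE] := jP 0%N (a y) (- b).
    by rewrite linearN bc linearN cE subrr.
  by exists x; apply: a_inj; rewrite e'E xE.
move=> i; apply: (@presentation_stable_summand _ finR _ (X i) _ (r i) (j i)).
split=> //; first exact: projective_prod.
apply: range_setT; case: i => [|i] c.
  have [x xc] := range_setTP p_surj (e c).
  have [b _ bE] : range (d 0%N) (c - s x).
    by rewrite de_exact /ker /= linearB sE xc subrr.
  have [y yb] := q_surj 0%N b.
  by exists (x, y); rewrite /= yb bE addrC subrK.
by have [x <-] := q_surj i c; exists (x, 0); rewrite /= !linear0 addr0.
Qed.

End SyzygyResolution.

Lemma nat_inf_min (S : set nat) m :
  S m -> (forall n, S n -> (m <= n)%N) -> nat_inf S = m%:Z%:E.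
Proof.
move=> Sm m_min; rewrite /nat_inf /infimum ifF; last first.
  by apply/eqP => S0; have : set0 (m%:Z%:E : \bar int) by rewrite -S0; exists m.
apply: xget_subset1; last exact: (@is_subset1_infimums _ _ _).
split=> [_ [n Sn <-]|y lb_y]; first by rewrite lee_fin lez_nat m_min.
by apply: lb_y; exists m.
Qed.

Lemma nat_inf0 (S : set nat) : ~ (exists n, S n) -> nat_inf S = +oo%E.
Proof.
move=> S0; rewrite /nat_inf (_ : [set n%:Z%:E | n in S] = set0).
  by rewrite /infimum eqxx.
by apply/seteqP; split=> // x [n Sn _]; apply: S0; exists n.
Qed.

Lemma nat_inf_leP (S : set nat) n :
  (nat_inf S <= n%:Z%:E)%E <-> exists2 m, S m & (m <= n)%N.
Proof.
split=> [|[m Sm mn]].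
  have [[m Sm]|/nat_inf0->//] := pselect (exists m, S m).
  have ex_S : exists m, `[< S m >] by exists m; apply/asboolP.
  have [l /asboolP Sl l_min] := ex_minnP ex_S.
  rewrite (nat_inf_min Sl) => [|k Sk]; last exact/l_min/asboolP.
  by rewrite lee_fin lez_nat; exists l.
have ex_S : exists m, `[< S m >] by exists m; apply/asboolP.
have [l /asboolP Sl l_min] := ex_minnP ex_S.
rewrite (nat_inf_min Sl) => [|k Sk]; last exact/l_min/asboolP.
by rewrite lee_fin lez_nat (leq_trans _ mn) //; apply/l_min/asboolP.
Qed.

Lemma nat_inf_lt_pinftyP (S : set nat) :
  (nat_inf S < +oo)%E <-> exists n, S n.
Proof.
split=> [|[n Sn]].
  by have [|/nat_inf0->] := pselect (exists m, S m).
by apply: le_lt_trans (ltry n%:Z); apply/nat_inf_leP; exists n.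
Qed.

Section DelooingLevelShift.
Variable R : pzRingType.
Hypothesis finR : finite_over_field R.
Implicit Types M C D N : fgModType R.

Lemma dell_syzygy j C D (n : nat) : stable_summand D (syzygy C) ->
  (dell j C <= n%:Z%:E)%E -> (dell j.+1 D <= n%:Z%:E)%E.
Proof.
move=> DC /nat_inf_leP[l [N CN] ln]; apply/nat_inf_leP; exists l => //.
exists N; rewrite addnS.
apply: stable_summand_trans (stable_summand_syzygy_iter finR l DC) _.
rewrite /syzygy_iter -iterSr; exact: stable_summand_syzygy.
Qed.

Lemma dell_succ j C (n : nat) :
  (dell j.+1 C <= n%:Z%:E)%E -> (dell j C <= n%:Z%:E)%E.
Proof.
move=> /nat_inf_leP[l [N CN] ln]; apply/nat_inf_leP; exists l => //.
by exists (syzygy N); rewrite /syzygy_iter -iterSr -addnS.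
Qed.

Lemma ddell_syzygy k M :
  (ddell k M < +oo)%E -> (ddell k.+1 (syzygy M) < +oo)%E.
Proof.
move=> /nat_inf_lt_pinftyP[m [n [nm [C [d [e [C_res C_dell]]]]]]].
have [D [d' [e' [D_res DC]]]] := syzygy_resolution finR C_res.
apply/nat_inf_lt_pinftyP; exists m, n; split=> //.
exists D, d', e'; split=> // i i_n; have := C_dell i i_n.
by rewrite addnS subzn ?(leq_trans i_n) //; apply: dell_syzygy.
Qed.

Lemma ddell_succ k M : (ddell k.+1 M < +oo)%E -> (ddell k M < +oo)%E.
Proof.
move=> /nat_inf_lt_pinftyP[m [n [nm [C [d [e [C_res C_dell]]]]]]].
apply/nat_inf_lt_pinftyP; exists m, n; split=> //.
exists C, d, e; split=> // i i_n; have := C_dell i i_n.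
by rewrite addnS subzn ?(leq_trans i_n) //; apply: dell_succ.
Qed.

End DelooingLevelShift.

Lemma falg_finite_over_field (F : fieldType) (A : falgType F) :
  finite_over_field A^c.
Proof.
exists F, (fun a => a%:A : A^c), (\dim {:A}), (fun i => (vbasis {:A})`_i : A^c).
split=> [a b|a b|x]; first exact: scalerDl.
  by rewrite -[RHS]/((b%:A : A) * a%:A) -scalerAl mul1r scalerA mulrC.
exists (fun i => coord (vbasis {:A}) i x).
rewrite {1}(coord_vbasis (memvf (x : A))).
by apply: eq_bigr => i _; rewrite -[RHS]/(_ * (_ : A)) -scalerAr mulr1.
Qed.

Theorem lemma3p2 (F : fieldType) (A : falgType F) (k : nat) (hk : (1 <= k)%N)
    (M : right_fgModType A) (hM : (ddell k M < +oo)%E) :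
  (ddell k.+1 (syzygy M) < +oo)%E /\ (ddell k (syzygy M) < +oo)%E.
Proof.
have hS := ddell_syzygy (falg_finite_over_field A) hM.
by split; last exact: ddell_succ.
Qed.
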